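(* Let $\Lambda$ be a right $2$-Nakayama artin algebra and let $M$ be an indecomposable right $\Lambda$-module. Then there exist an indecomposable projective right $\Lambda$-module $P$ and a submodule $N$ of $P$ such that $M\cong P/N$. More precisely: if $P$ is an indecomposable projective uniserial module, then $M\cong P/\mathrm{rad}^i(P)$ for some $1\le i\le \ell\ell(P)$; and if $P$ is an indecomposable projective $2$-factor serial module with $\mathrm{rad}(P)=\mathrm{soc}(P)=S_1\oplus S_2$ ($S_1,S_2$ simple submodules of $P$), then $M$ is isomorphic to $P$, or to $P/\mathrm{rad}(P)$, or to $P/S_i$ for some $1\le i\le 2$.
   Context: An artin algebra is an algebra $\Lambda$ over a commutative artinian ring $R$ that is finitely generated as an $R$-module. All modules are finitely generated right $\Lambda$-modules; $\ell\ell(M)$ denotes the Loewy length of $M$. For a module $M$ put $\mathrm{rad}^0(M)=M$, $\mathrm{rad}^{i+1}(M)=\mathrm{rad}(\mathrm{rad}^i(M))$. A module is uniserial if it has a unique composition series (the zero module counts as uniserial). Let $M$ be a nonzero module of length $l$. $M$ is $1$-factor serial if it is uniserial; for $l\ge 2$, $M$ is $2$-factor serial if $M/\mathrm{rad}^{l-2}(M)$ is uniserial and $M/\mathrm{rad}^{l-1}(M)$ is not uniserial. $\Lambda$ is right $2$-Nakayama if every indecomposable right $\Lambda$-module is $1$-factor serial or $2$-factor serial and there exists at least one indecomposable $2$-factor serial right $\Lambda$-module. *)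

(* Defs.v *)
From HB Require Import structures.
From mathcomp Require Import all_boot all_algebra.
From mathcomp Require Import boolp classical_sets.

Set Implicit Arguments.
Unset Strict Implicit.
Unset Printing Implicit Defensive.

Import GRing.Theory.
Local Open Scope ring_scope.
Local Open Scope quotient_scope.

(* Submodules of V are the predicates N : submodClosed V; two of them are
   compared extensionally ({subset _ <= _} and =i).  Since {pred V} is
   bool-valued, submodules defined by a proposition go through boolp's
   [`[< _ >]]. *)

Section QuotientModule.
Variables (A : pzRingType) (V : lmodType A) (N : submodClosed V).

(* submodClosed does not inherit from zmodClosed, which {quot _} expects. *)
Lemma submod_zmod_closed : zmod_closed N.
Proof. exact/GRing.submod_closedB/submodClosedP. Qed.

Definition submod_pred : {pred V} := N.
HB.instance Definition _ :=
  GRing.isZmodClosed.Build V submod_pred submod_zmod_closed.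
Definition submod_zmod : zmodClosed V := submod_pred.

Definition quotmod := Quotient.quot submod_zmod.

HB.instance Definition _ := GRing.Zmodule.on quotmod.
HB.instance Definition _ :=
  EqQuotient.copy quotmod (Quotient.quot submod_zmod).

Definition quotmod_scale (a : A) : quotmod -> quotmod :=
  fun q => \pi_quotmod (a *: repr q).

Lemma quotmod_eqP (x y : V) : reflect (x = y %[mod quotmod]) (x - y \in N).
Proof. by rewrite [_ \in N](Quotient.idealrBE submod_zmod); exact: eqP. Qed.

Lemma quotmod_scale_pi a x :
  quotmod_scale a (\pi_quotmod x) = \pi_quotmod (a *: x).
Proof.
apply/quotmod_eqP; rewrite -scalerBr rpredZ //.
by apply/quotmod_eqP; rewrite reprK.
Qed.

Lemma quotmod_piD x y :
  \pi_quotmod (x + y) = \pi_quotmod x + \pi_quotmod y.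
Proof. exact: (Quotient.pi_add submod_zmod). Qed.

Lemma quotmod_scaleA a b q :
  quotmod_scale a (quotmod_scale b q) = quotmod_scale (a * b) q.
Proof.
by elim/quotW: q => x; rewrite (quotmod_scale_pi b) !quotmod_scale_pi scalerA.
Qed.

Lemma quotmod_scale1 : left_id 1 quotmod_scale.
Proof. by elim/quotW=> x; rewrite quotmod_scale_pi scale1r. Qed.

Lemma quotmod_scaleDr : right_distributive quotmod_scale +%R.
Proof.
move=> a; elim/quotW=> x; elim/quotW=> y; rewrite -quotmod_piD.
by rewrite !quotmod_scale_pi scalerDr quotmod_piD.
Qed.

Lemma quotmod_scaleDl q : {morph quotmod_scale^~ q : a b / a + b}.
Proof.
by move=> a b; elim/quotW: q => x; rewrite !quotmod_scale_pi scalerDl quotmod_piD.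
Qed.

HB.instance Definition _ := GRing.Zmodule_isLmodule.Build A quotmod
  quotmod_scaleA quotmod_scale1 quotmod_scaleDr quotmod_scaleDl.

End QuotientModule.

Section Submodules.
Variables (A : pzRingType) (V : lmodType A).
Implicit Types (K L N S : submodClosed V).

Definition zero_pred : {pred V} := pred1 0.
Lemma zero_pred_closed : subsemimod_closed zero_pred.
Proof.
split=> [|a x]; last by rewrite !inE => /eqP->; rewrite scaler0.
by split=> [|x y]; rewrite !inE // => /eqP-> /eqP->; rewrite addr0.
Qed.
HB.instance Definition _ :=
  GRing.isSubSemiModClosed.Build A V zero_pred zero_pred_closed.
Definition zero_submod : submodClosed V := zero_pred.

Definition full_pred : {pred V} := predT.
Lemma full_pred_closed : subsemimod_closed full_pred.
Proof. by []. Qed.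
HB.instance Definition _ :=
  GRing.isSubSemiModClosed.Build A V full_pred full_pred_closed.
Definition full_submod : submodClosed V := full_pred.

Definition maximal_submod_of K N : Prop :=
  [/\ {subset K <= N}, ~ {subset N <= K} &
      forall L, {subset K <= L} -> {subset L <= N} -> L =i K \/ L =i N].

Definition simple_submod S : Prop :=
  ~ {subset S <= zero_submod} /\
  forall L, {subset L <= S} -> L =i zero_submod \/ L =i S.

(* The submodule rad(N) of V; the submodules of N are those of V that are
   contained in N. *)
Definition rad_pred N : {pred V} :=
  [pred x | (x \in N) && `[< forall K, maximal_submod_of K N -> x \in K >]].
Lemma rad_pred_closed N : subsemimod_closed (rad_pred N).
Proof.
split=> [|a x].
  split=> [|x y].
    by rewrite !inE rpred0; apply/asboolP => K _; exact: rpred0.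
  rewrite !inE => /andP[Nx /asboolP rx] /andP[Ny /asboolP ry].
  by rewrite rpredD //; apply/asboolP => K mK; rewrite rpredD ?rx ?ry.
rewrite !inE => /andP[Nx /asboolP rx].
by rewrite rpredZ //; apply/asboolP => K mK; rewrite rpredZ ?rx.
Qed.
HB.instance Definition _ N :=
  GRing.isSubSemiModClosed.Build A V (rad_pred N) (rad_pred_closed N).
Definition rad N : submodClosed V := rad_pred N.

Definition radn (i : nat) : submodClosed V := iter i rad full_submod.

Definition soc_pred : {pred V} :=
  [pred x | `[< exists s : seq V, x = \sum_(y <- s) y /\
     forall y, y \in s -> exists2 S, simple_submod S & y \in S >]].
Lemma soc_predP x : reflect (exists s : seq V, x = \sum_(y <- s) y /\
    forall y, y \in s -> exists2 S, simple_submod S & y \in S) (x \in soc_pred).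
Proof. exact: asboolP. Qed.
Lemma soc_pred_closed : subsemimod_closed soc_pred.
Proof.
split=> [|a x].
  split=> [|x y].
    by apply/soc_predP; exists [::]; rewrite big_nil.
  move=> /soc_predP[s [-> hs]] /soc_predP[t [-> ht]].
  apply/soc_predP; exists (s ++ t); rewrite big_cat; split=> // z.
  by rewrite mem_cat => /orP[/hs|/ht].
move=> /soc_predP[s [-> hs]].
apply/soc_predP; exists [seq a *: y | y <- s]; rewrite big_map scaler_sumr.
by split=> // _ /mapP[y /hs[S sS Sy] ->]; exists S; rewrite ?rpredZ.
Qed.
HB.instance Definition _ :=
  GRing.isSubSemiModClosed.Build A V soc_pred soc_pred_closed.
Definition soc : submodClosed V := soc_pred.

Definition direct_sum N K L : Prop :=
  (forall x, x \in N <-> exists y z, [/\ y \in K, z \in L & x = y + z]) /\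
  (forall x, x \in K -> x \in L -> x = 0).

(* The chain 0 = c 0 < c 1 < ... < c l = V; the values of c beyond l are
   irrelevant. *)
Definition composition_series (l : nat) (c : nat -> submodClosed V) : Prop :=
  [/\ c 0%N =i zero_submod, c l =i full_submod &
      forall i, (i < l)%N -> maximal_submod_of (c i) (c i.+1)].

End Submodules.

Arguments radn {A} V i.
Arguments soc {A} V.
Arguments zero_submod {A} V.
Arguments full_submod {A} V.
Arguments composition_series {A} V l c.

Section Modules.
Variable A : pzRingType.
Implicit Types V U : lmodType A.

Definition isomorphic V U : Prop := exists f : {linear V -> U}, bijective f.

Definition finitely_generated V : Prop :=
  exists s : seq V, forall x : V, exists a : 'I_(size s) -> A,
    x = \sum_(i < size s) a i *: s`_i.

Definition nonzero_module V : Prop := exists x : V, x != 0.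

Definition indecomposable V : Prop :=
  nonzero_module V /\
  forall K L : submodClosed V, direct_sum (full_submod V) K L ->
    K =i zero_submod V \/ L =i zero_submod V.

Definition projective V : Prop :=
  forall (U W : lmodType A) (g : {linear U -> W}) (f : {linear V -> W}),
    (forall w, exists u, g u = w) ->
    exists h : {linear V -> U}, forall v, g (h v) = f v.

(* Composition length; 0 by convention if there is no composition series. *)
Definition module_length V : nat :=
  xget 0%N [set l | exists c, composition_series V l c]%classic.

(* The least n with rad^n(V) = 0; 0 by convention if there is none. *)
Definition loewy_length V : nat :=
  xget 0%N [set n | radn V n =i zero_submod V /\
    forall m, radn V m =i zero_submod V -> (n <= m)%N]%classic.

Definition uniserial V : Prop :=
  exists l c, composition_series V l c /\
    forall l' c', composition_series V l' c' ->
      l' = l /\ forall i, (i <= l)%N -> c' i =i c i.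

Definition one_factor_serial V : Prop := nonzero_module V /\ uniserial V.

Definition two_factor_serial V : Prop :=
  let l := module_length V in
  [/\ nonzero_module V, (2 <= l)%N,
      uniserial (quotmod (radn V (l - 2))) &
      ~ uniserial (quotmod (radn V (l - 1)))].

End Modules.

(* R^o is R as a module over itself, whose submodules are the ideals of R. *)
Definition artinian_ring (R : comPzRingType) : Prop :=
  forall I : nat -> submodClosed R^o,
    (forall n, {subset I n.+1 <= I n}) ->
    exists n, forall m, (n <= m)%N -> I m =i I n.

Definition artin_algebra (R : comPzRingType) (Lambda : algType R) : Prop :=
  artinian_ring R /\ finitely_generated (Lambda : lmodType R).

(* A right module is a left module over the converse ring: a *: x is x a. *)
Notation rmodType Lambda := (lmodType (Lambda : pzRingType)^c).

Definition right_2_Nakayama (Lambda : pzRingType) : Prop :=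
  (forall M : rmodType Lambda, finitely_generated M -> indecomposable M ->
     one_factor_serial M \/ two_factor_serial M) /\
  (exists M : rmodType Lambda,
     [/\ finitely_generated M, indecomposable M & two_factor_serial M]).

(* Main.v *)
(* The key point is that over a right 2-Nakayama algebra every finitely
   generated indecomposable module is local: it has a largest proper submodule.
   Hence M is an image of Lambda, and among the idempotents e such that M is
   still an image of e Lambda a minimal one gives an indecomposable projective.

   If P is uniserial, its submodules are the terms of its composition series,
   which are the rad^i(P). If rad(P) = S1 (+) S2, the delicate quotients are the
   P/N with N a diagonal simple submodule of S1 (+) S2. Then S2 is a complement
   in rad(P) of both N and S1, and the amalgam X of P/N and P/S1 along their
   socles, both identified with S2, is not local, so it has a nonzero summand B
   that meets the common socle trivially. Then B is a complement in X to both
   P/N and P/S1, and P/N ~ X/B ~ P/S1. *)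
Require Import Defs.
From HB Require Import structures.
From mathcomp Require Import all_boot all_algebra.
From mathcomp Require Import boolp classical_sets zify.

Set Implicit Arguments.
Unset Strict Implicit.
Unset Printing Implicit Defensive.

Import GRing.Theory.
Local Open Scope ring_scope.
Local Open Scope quotient_scope.

(** * Sums, intersections and maximality of submodules *)

Section Submodules.
Variables (A : pzRingType) (V : lmodType A).
Implicit Types (K L N : submodClosed V) (P : V -> Prop).

(** Later submodules are obtained from this existence statement, which keeps the passage from [Prop]
    to boolean predicates inside one proof. *)
Lemma submod_comprehension P :
    P 0 -> (forall x y, P x -> P y -> P (x + y)) ->
    (forall a x, P x -> P (a *: x)) ->
  exists K, forall x, x \in K <-> P x.
Proof.
move=> P0 PD PZ; pose p : {pred V} := fun x => `[< P x >].
have pc : subsemimod_closed p.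
  split=> [|a x /asboolP Px]; last exact/asboolP/PZ.
  split=> [|x y /asboolP Px /asboolP Py]; first exact/asboolP.
  exact/asboolP/PD.
pose K : submodClosed V :=
  HB.pack p (GRing.isSubSemiModClosed.Build A V p pc).
by exists K => x; split=> /asboolP.
Qed.

Lemma submodB N x y : x \in N -> y \in N -> x - y \in N.
Proof. exact: (@submod_zmod_closed A V N).2. Qed.

Lemma submodN N x : x \in N -> - x \in N.
Proof. by move=> Nx; rewrite -sub0r submodB ?rpred0. Qed.

Lemma eq_submod K L : {subset K <= L} -> {subset L <= K} -> K =i L.
Proof. by move=> KL LK x; apply/idP/idP => [/KL|/LK]. Qed.

Lemma addm_ex K L : exists S : submodClosed V, forall x, x \in S <->
  exists y z, [/\ y \in K, z \in L & x = y + z].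
Proof.
apply: submod_comprehension.
- by exists 0, 0; rewrite !rpred0 addr0.
- move=> _ _ [y [z [Ky Lz ->]]] [y' [z' [Ky' Lz' ->]]].
  by exists (y + y'), (z + z'); rewrite !rpredD // addrACA.
- move=> a _ [y [z [Ky Lz ->]]].
  by exists (a *: y), (a *: z); rewrite !rpredZ // scalerDr.
Qed.

Definition addm K L := projT1 (cid (addm_ex K L)).

Lemma addmP K L x :
  x \in addm K L <-> exists y z, [/\ y \in K, z \in L & x = y + z].
Proof. exact: (projT2 (cid (addm_ex K L))). Qed.

Lemma capm_ex K L : exists S : submodClosed V, forall x, x \in S <->
  x \in K /\ x \in L.
Proof.
apply: submod_comprehension; first by rewrite !rpred0.
  by move=> x y [Kx Lx] [Ky Ly]; rewrite !rpredD.
by move=> a x [Kx Lx]; rewrite !rpredZ.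
Qed.

Definition capm K L := projT1 (cid (capm_ex K L)).

Lemma capmP K L x : x \in capm K L <-> x \in K /\ x \in L.
Proof. exact: (projT2 (cid (capm_ex K L))). Qed.

Lemma addml K L : {subset K <= addm K L}.
Proof. by move=> x Kx; apply/addmP; exists x, 0; rewrite rpred0 addr0. Qed.

Lemma addmr K L : {subset L <= addm K L}.
Proof. by move=> x Lx; apply/addmP; exists 0, x; rewrite rpred0 add0r. Qed.

Lemma addm_sub K L N :
  {subset K <= N} -> {subset L <= N} -> {subset addm K L <= N}.
Proof. by move=> KN LN _ /addmP[y [z [/KN Ny /LN Nz ->]]]; rewrite rpredD. Qed.

Lemma addmS K L N : {subset L <= N} -> {subset addm K L <= addm K N}.
Proof.
move=> LN; apply: addm_sub; first exact: addml.
by move=> x /LN; apply: addmr.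
Qed.

Lemma capm_sub K L N :
  {subset N <= K} -> {subset N <= L} -> {subset N <= capm K L}.
Proof. by move=> NK NL x Nx; apply/capmP; rewrite NK ?NL. Qed.

(** By the modular law a submodule [X] between [L + K] and [L + N] is determined by [X :&: N], which
    lies between [K] and [N]. The second hypothesis excludes a collapsed factor. *)
Lemma maximal_addm K N L : maximal_submod_of K N ->
  ~ {subset addm L N <= addm L K} ->
  maximal_submod_of (addm L K) (addm L N).
Proof.
move=> [KN NnK maxK] nNK; split=> //; first exact: addmS.
move=> X KX XN.
have [||e|e] := maxK (capm X N).
- by apply: capm_sub => // x Kx; apply/KX/addmr.
- by move=> x /capmP[].
- left; apply: eq_submod => // x Xx; have /addmP[y [z [Ly Nz xE]]] := XN x Xx.
  rewrite xE rpredD //; first exact: addml.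
  apply: addmr; rewrite -e; apply/capmP; split=> //.
  have -> : z = x - y by rewrite xE addrC addKr.
  by rewrite submodB // KX // addml.
- right; apply: eq_submod => //; apply: addm_sub => [x Lx|x].
    exact/KX/addml.
  by rewrite -e => /capmP[].
Qed.

(** For [X] between [L :&: K] and [L], the sum [X + K] is [K] or [N]; the modular law recovers [X]
    in both cases. *)
Lemma maximal_capm K N L : maximal_submod_of K N -> {subset L <= N} ->
  ~ {subset L <= K} -> maximal_submod_of (capm L K) L.
Proof.
move=> [KN NnK maxK] LN LnK; split=> [x /capmP[]//|sLK|X KX XL].
  by apply: LnK => x /sLK/capmP[].
have [||e|e] := maxK (addm X K).
- exact: addmr.
- by apply: addm_sub => // x /XL/LN.
- left; apply: eq_submod => //; apply: capm_sub => // x Xx.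
  by rewrite -e addml.
- right; apply: eq_submod => // x Lx.
  have : x \in addm X K by rewrite e LN.
  case/addmP=> y [z [Xy Kz xE]]; rewrite xE rpredD //; apply: KX.
  apply/capmP; split=> //; have -> : z = x - y by rewrite xE addrC addKr.
  by rewrite submodB // XL.
Qed.

Lemma maximal_eq K K' N N' : K =i K' -> N =i N' ->
  maximal_submod_of K N -> maximal_submod_of K' N'.
Proof.
move=> eK eN [KN NK maxK]; split=> [x|h|L K'L LN'].
- by rewrite -eK -eN; apply: KN.
- by apply: NK => x; rewrite eK eN; apply: h.
- have [x|x|e|e] := maxK L; rewrite ?eK ?eN; [exact: K'L|exact: LN'|left|right];
    by move=> x; rewrite e.
Qed.

Lemma rad_eq N N' : N =i N' -> Defs.rad N =i Defs.rad N'.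
Proof.
move=> eN x; rewrite !inE eN; congr (_ && _); apply: asbool_equiv_eq.
by split=> h K mK; apply: h; apply: maximal_eq mK.
Qed.

Lemma direct_sumC N K L :
  direct_sum N K L -> direct_sum N L K.
Proof.
move=> [NP KL0]; split=> [x|x Lx Kx]; last exact: KL0.
by rewrite NP; split=> -[y [z [? ? ->]]]; exists z, y; rewrite addrC.
Qed.

End Submodules.

(** * Composition series and uniserial modules *)

Section CompositionSeries.
Variables (A : pzRingType) (V : lmodType A).
Variables (l : nat) (c : nat -> submodClosed V).
Hypothesis cs : composition_series V l c.
Implicit Types (K L N : submodClosed V).

Lemma comp_series_le i j : (i <= j <= l)%N -> {subset c i <= c j}.
Proof.
have [_ _ mc] := cs; case/andP; elim: j => [|j IH].
  by rewrite leqn0 => /eqP-> _ x.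
rewrite leq_eqVlt => /predU1P[-> _ x|ij jl x cx] //.
by have [+ _ _] := mc j jl; apply; apply: IH; rewrite // ltnW.
Qed.

Lemma comp_series_lt i j : (i < j <= l)%N -> ~ {subset c j <= c i}.
Proof.
move=> /andP[ij jl] h; have [_ _ mc] := cs.
have [_ + _] := mc i (leq_trans ij jl); apply=> x cx; apply: h.
by apply: (@comp_series_le i.+1) => //; rewrite ij.
Qed.

(** The least [i] with [L + c i = V] is positive as [L] is proper, and [L + c i.-1] is then
    maximal. *)
Lemma proper_sub_maximal L : ~ {subset full_submod V <= L} ->
  exists2 K, maximal_submod_of K (full_submod V) & {subset L <= K}.
Proof.
have [c0 cl mc] := cs => Lpr.
pose p i := `[< {subset full_submod V <= addm L (c i)} >].
have pl : exists i, p i.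
  by exists l; apply/asboolP => x _; apply: addmr; rewrite cl.
have /asboolP := ex_minnP pl; case: ex_minnP => -[|i] /asboolP fi mini.
  move=> _; case: Lpr => x /fi/addmP[y [z [Ly]]].
  by rewrite c0 => /eqP-> ->; rewrite addr0.
move=> _; have il : (i < l)%N.
  by apply: mini; apply/asboolP => x _; apply: addmr; rewrite cl.
have nfi : ~ {subset full_submod V <= addm L (c i)}.
  by move=> /asboolP/mini; rewrite ltnn.
exists (addm L (c i)); last exact: addml.
have e : addm L (c i.+1) =i full_submod V by apply: eq_submod.
apply: maximal_eq e (maximal_addm (mc i il) _) => // h.
by apply: nfi => x /fi/h.
Qed.

Hypothesis uniq_cs : forall l' c', composition_series V l' c' ->
  l' = l /\ forall i, (i <= l)%N -> c' i =i c i.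

(* Otherwise N can replace a term of the series: if N is contained in c i.+1
   but not in c i, and N :&: c i = c j, then c 0 < ... < c j < N = N + c j <
   N + c j.+1 < ... < N + c i = c i.+1 < ... is another composition series. *)
Lemma uniserial_submod N : exists2 j, (j <= l)%N & N =i c j.
Proof.
have [c0 cl mc] := cs.
suff: forall i, (i <= l)%N -> forall N, {subset N <= c i} ->
    exists2 j, (j <= i)%N & N =i c j.
  by apply=> // x _; rewrite cl.
elim=> [_|i IH il] {}N Nci.
  exists 0%N => //; apply: eq_submod => // x.
  by rewrite c0 => /eqP->; apply: rpred0.
have [Ni|Nni] := EM {subset N <= c i}.
  by have [j ji e] := IH (ltnW il) N Ni; exists j => //; rewrite leqW.
have [|j ji ecj] := IH (ltnW il) (capm N (c i)); first by move=> x /capmP[].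
have [_ _ maxi] := mc i il.
have addNi : addm N (c i) =i c i.+1.
  have [|||//] := maxi (addm N (c i)); first exact: addmr.
    by apply: addm_sub => //; apply: comp_series_le; rewrite leqnSn.
  by move=> e; case: Nni => x Nx; rewrite -e addml.
have cjN : {subset c j <= N} by move=> x; rewrite -ecj => /capmP[].
have addNj : addm N (c j) =i N.
  by apply: eq_submod; [apply: addm_sub | apply: addml].
pose c' m := if (j < m <= i.+1)%N then addm N (c m.-1) else c m.
have cs' : composition_series V l c'.
  split=> [||m ml]; first by rewrite /c' ltn0.
    rewrite /c'; case: ifP => // /andP[jl li] x.
    have le : l = i.+1 by apply/eqP; rewrite eqn_leq li.
    by rewrite le addNi -le cl.
  have [mj|jm|mj] := ltngtP m j.
  - by rewrite /c' !ifF; [exact: mc | lia | lia].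
  - have [mi|im|mi] := ltngtP m i.+1.
    + rewrite /c' !ifT; [|lia|lia]; case: m jm mi ml => // m jm mi ml /=.
      apply: maximal_addm; first by apply: mc; lia.
      (* If an element of [c m.+1] lies in [N + c m], its component in [N] lies in
         [N :&: c i = c j], hence in [c m]; so the factor cannot collapse. *)
      move=> h; apply: (@comp_series_lt m m.+1); first by lia.
      move=> x cx; have /addmP[y [z [Ny cz xE]]] := h x (addmr _ cx).
      rewrite xE rpredD //; apply: (@comp_series_le j); first by lia.
      rewrite -ecj; apply/capmP; split=> //.
      apply: (@comp_series_le m.+1); first by lia.
      have -> : y = x - z by rewrite xE addrK.
      by rewrite submodB //; apply: comp_series_le cz; lia.
    + by rewrite /c' !ifF; [exact: mc | lia | lia].
    + rewrite /c' ifT ?ifF; [|lia|lia]; rewrite mi /= -mi.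
      by apply: maximal_eq (mc m ml) => // x; rewrite mi addNi.
  - rewrite mj /c' ifF ?ifT; [|lia|lia] => /=.
    apply: maximal_eq ecj _ (maximal_capm (mc i il) Nci Nni) => x.
    by rewrite addNj.
(* At index [j.+1] uniqueness identifies [N + c j], which is [N], with [c j.+1]. *)
have [_ /(_ j.+1)] := uniq_cs cs'.
rewrite /c' ltnSn /= ltnS ji => /(_ (leq_trans _ il)) e.
by exists j.+1 => // x; rewrite -e // addNj.
Qed.

Lemma comp_series_sub_lt i j : (j <= l)%N -> (i <= l)%N ->
  ~ {subset c j <= c i} -> (i < j)%N.
Proof.
move=> jl il nji; rewrite ltnNge; apply/negP => ji; apply: nji.
by apply: comp_series_le; rewrite ji.
Qed.

(** As every submodule is a term of the series, [c k] is the only maximal submodule of [c k.+1], and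
    each radical descends by exactly one term. *)
Lemma radn_uniserial i : (i <= l)%N -> radn V i =i c (l - i).
Proof.
have [c0 cl mc] := cs.
elim: i => [_ x|i IH il]; first by rewrite subn0 cl.
have il' : (l - i.+1 < l)%N by lia.
have e := IH (ltnW il); have -> : (l - i.+1)%N = (l - i).-1 by lia.
case k: (l - i)%N e => [|k'] e /=; first by lia.
have mk : maximal_submod_of (c k') (c k'.+1) by apply: mc; lia.
move=> x; rewrite [LHS](rad_eq e) !inE; apply/andP/idP.
  by move=> [_ /asboolP]; apply.
move=> cx; have [sk _ _] := mk; split; first exact: sk.
apply/asboolP => K mK; have [j jl eK] := uniserial_submod K.
have [Kk nkK maxK] := mK.
have jk : (j <= k')%N.
  rewrite -ltnS; apply: comp_series_sub_lt => // [|h]; first by lia.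
  by apply: nkK => y /h; rewrite eK.
have [||h|h] := maxK (c k'); rewrite -?h //.
  by move=> y; rewrite eK; apply: comp_series_le; lia.
by case: mk => _ + _; case=> y; rewrite h.
Qed.

Lemma loewy_length_uniserial : (l <= loewy_length V)%N.
Proof.
have [c0 cl mc] := cs.
have eV m : radn V m =i zero_submod V -> (l <= m)%N.
  move=> e; rewrite leqNgt; apply/negP => ml.
  apply: (@comp_series_lt 0 (l - m)) => [|x]; first by lia.
  by rewrite -radn_uniserial ?e ?c0 // ltnW.
(* The set contains [l], so [xget] does not fall back to its default [0]. *)
have lV : [set n | radn V n =i zero_submod V /\
    forall m, radn V m =i zero_submod V -> (n <= m)%N]%classic l.
  by split=> // x; rewrite radn_uniserial // subnn c0.
by have [/eV] := xgetI 0%N lV.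
Qed.

End CompositionSeries.

(** * Local modules *)

Section Local.
Variables (A : pzRingType) (V : lmodType A).
Implicit Types (J K L N : submodClosed V).

Definition largest_proper_submod J : Prop :=
  ~ {subset full_submod V <= J} /\
  forall L, ~ {subset full_submod V <= L} -> {subset L <= J}.

Definition local_module : Prop := exists J, largest_proper_submod J.

Lemma largest_proper_maximal J :
  largest_proper_submod J -> maximal_submod_of J (full_submod V).
Proof.
move=> [Jpr Jmax]; split=> // L JL _.
have [fL|/Jmax LJ] := EM {subset full_submod V <= L}.
  by right; apply: eq_submod.
by left; apply: eq_submod.
Qed.

Lemma largest_proper_rad J : largest_proper_submod J -> J =i radn V 1.
Proof.
move=> Jl; have [_ Jmax] := Jl; have mJ := largest_proper_maximal Jl.
move=> x; rewrite !inE /=; apply/idP/asboolP => [Jx K|]; last exact.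
move=> [_ Kpr maxK]; have [|//|e|e] := maxK J; first exact: Jmax.
  by rewrite -e.
by case: mJ => _ + _; case=> y; rewrite e.
Qed.

(** The proper submodules are the terms [c j] with [j < l], and [c l.-1] contains them all. *)
Lemma uniserial_local : nonzero_module V -> uniserial V -> local_module.
Proof.
move=> [v v0] [l [c [cs uniq_cs]]]; have [c0 cl mc] := cs.
have l0 : (0 < l)%N.
  rewrite lt0n; apply/eqP => l0; have : v \in full_submod V by [].
  by rewrite -cl l0 c0 inE (negPf v0).
have lE : l.-1.+1 = l by rewrite prednK.
exists (c l.-1); split=> [h|L Lpr].
  have ll : (l.-1 < l)%N by rewrite lE.
  by have [_ + _] := mc l.-1 ll; apply=> x _; apply: h.
have [j jl e] := uniserial_submod cs uniq_cs L.
have jl' : (j < l)%N.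
  apply: (comp_series_sub_lt cs) => // h; apply: Lpr => x fx.
  by rewrite e h // cl.
by move=> x; rewrite e; apply: (comp_series_le cs); lia.
Qed.

End Local.

(** * Quotient maps and the first isomorphism theorem *)

Section Isomorphisms.
Variable A : pzRingType.
Implicit Types V U W : lmodType A.

Lemma linear_of V W (f : V -> W) :
  linear f -> exists g : {linear V -> W}, forall x, g x = f x.
Proof.
move=> fl; pose g : {linear V -> W} :=
  HB.pack f (GRing.isLinear.Build A V W *:%R f fl).
by exists g.
Qed.

Lemma isomorphic_trans V U W :
  isomorphic V U -> isomorphic U W -> isomorphic V W.
Proof.
move=> [f fbij] [g gbij].
have [h hE] : exists h : {linear V -> W}, forall x, h x = g (f x).
  by apply: linear_of => a x y; rewrite !linearP.
by exists h; apply: (eq_bij (bij_comp gbij fbij)) => x; rewrite hE.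
Qed.

Lemma isomorphic_sym V U : isomorphic V U -> isomorphic U V.
Proof.
move=> [f [g fK gK]].
have [h hE] : exists h : {linear U -> V}, forall x, h x = g x.
  by apply: linear_of => a x y; apply: (can_inj fK); rewrite linearP !gK.
by exists h, f => x; rewrite hE.
Qed.

Section Quotient.
Variables (V : lmodType A) (N : submodClosed V).

Definition quot_proj (x : V) : quotmod N := \pi_(quotmod N) x.

Lemma quot_proj_linear : linear quot_proj.
Proof. by move=> a x y; rewrite /quot_proj quotmod_piD -quotmod_scale_pi. Qed.

HB.instance Definition _ :=
  GRing.isLinear.Build A V (quotmod N) *:%R quot_proj quot_proj_linear.

Lemma quot_proj_surj q : exists x, quot_proj x = q.
Proof. by exists (repr q); rewrite /quot_proj reprK. Qed.

Lemma quot_proj_eq x y : quot_proj x = quot_proj y <-> x - y \in N.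
Proof. by rewrite /quot_proj; split=> /(quotmod_eqP N x y). Qed.

Lemma quot_proj_eq0 x : quot_proj x = 0 <-> x \in N.
Proof. by rewrite -(linear0 quot_proj) quot_proj_eq subr0. Qed.

Lemma quot_lift W (f : {linear V -> W}) : (forall x, x \in N -> f x = 0) ->
  exists g : {linear quotmod N -> W}, forall x, g (quot_proj x) = f x.
Proof.
move=> fN; pose g (q : quotmod N) := f (repr q).
have gE x : g (quot_proj x) = f x.
  apply/eqP; rewrite -subr_eq0 -linearB; apply/eqP/fN/quot_proj_eq.
  by rewrite /quot_proj reprK.
have [h hE] : exists h : {linear quotmod N -> W}, forall q, h q = g q.
  apply: linear_of => a q r.
  have [[x <-] [y <-]] := (quot_proj_surj q, quot_proj_surj r).
  by rewrite -linearP !gE linearP.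
by exists h => x; rewrite hE gE.
Qed.

End Quotient.

Lemma first_isomorphism V W (N : submodClosed V) (f : {linear V -> W}) :
    (forall w, exists x, f x = w) -> (forall x, f x = 0 <-> x \in N) ->
  isomorphic W (quotmod N).
Proof.
move=> fsurj fker; apply: isomorphic_sym.
have [g gE] := quot_lift (fun x => (fker x).2); exists g.
have [s sK] := choice fsurj.
exists (fun w => quot_proj N (s w)) => [q|w]; last by rewrite gE.
have [x <-] := quot_proj_surj q; apply/quot_proj_eq/fker.
by rewrite linearB gE sK subrr.
Qed.

Lemma quotmod_preimage V N (K : submodClosed (quotmod N)) :
  exists L : submodClosed V, forall x, x \in L <-> quot_proj N x \in K.
Proof.
apply: submod_comprehension => [|x y Kx Ky|a x Kx].
- by rewrite linear0 rpred0.
- by rewrite linearD rpredD.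
- by rewrite linearZ rpredZ.
Qed.

End Isomorphisms.

(** * Locality of indecomposable serial and 2-factor serial modules *)

Section Serial.
Variable A : pzRingType.
Implicit Types V : lmodType A.

Lemma radn_anti V i j : (i <= j)%N -> {subset radn V j <= radn V i}.
Proof.
elim: j => [|j IH]; first by rewrite leqn0 => /eqP-> x.
rewrite leq_eqVlt => /predU1P[-> x //|ij x].
by rewrite inE => /andP[jx _]; apply: IH jx.
Qed.

(** A proper [L] outside [c 1] would be a complement to it: [c 1] is simple, so they meet trivially,
    and maximal, so they span [V]. *)
Lemma local_of_length2 V c :
  indecomposable V -> composition_series V 2 c -> local_module V.
Proof.
move=> [_ indec] cs; have [c0 cl mc] := cs.
have [_ n01 max01] := mc 0%N isT; have [_ n12 max12] := mc 1%N isT.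
exists (c 1%N); split=> [h|L Lpr]; first by apply: n12 => x _; apply: h.
apply: contrapT => Lc.
have capL : capm L (c 1%N) =i zero_submod V.
  have [|x /capmP[]//|e x|e] := max01 (capm L (c 1%N)).
  - by move=> x; rewrite c0 => /eqP->; apply: rpred0.
  - by rewrite e c0.
  have cL : {subset c 1%N <= L} by move=> x; rewrite -e => /capmP[].
  have [//|x _|e2|e2] := max12 L; first by rewrite cl.
    by case: Lc => x; rewrite e2.
  by case: Lpr => x; rewrite e2 cl.
have addL : addm L (c 1%N) =i full_submod V.
  have [|x _|e|e x] := max12 (addm L (c 1%N)); first exact: addmr.
  - by rewrite cl.
  - by case: Lc => x Lx; rewrite -e addml.
  - by rewrite e cl.
have [|e|e] := indec L (c 1%N).
- split=> [x|x Lx cx]; first by rewrite -addL; apply: addmP.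
  by apply/eqP; rewrite -[_ == 0]/(x \in zero_submod V) -capL; apply/capmP.
- by apply: Lc => x; rewrite e => /eqP->; apply: rpred0.
- by apply: n01 => x; rewrite e c0.
Qed.

(** In length 2 the quotient by [radn V 0] is zero, and the previous lemma applies. In length at
    least 3, [radn V (l - 2)] lies in every maximal submodule, so the largest proper submodule of
    the uniserial quotient pulls back to [V]. *)
Lemma two_factor_serial_local V :
  indecomposable V -> two_factor_serial V -> local_module V.
Proof.
move=> Vind [Vn0]; set l := module_length V => l2 us _.
have [c cs] : exists c, composition_series V l c.
  rewrite /l /module_length in l2 *.
  by case: xgetP l2 => [n -> //|].
have [l3|l3] := leqP l 2.
  by apply: (@local_of_length2 V c) => //; have <- : l = 2%N by lia.
have [c0 cl mc] := cs; have lE : l.-1.+1 = l by lia.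
have ml : maximal_submod_of (c l.-1) (full_submod V).
  by apply: maximal_eq (mc l.-1 _) => //; rewrite lE.
have radK K : maximal_submod_of K (full_submod V) ->
    {subset radn V (l - 2) <= K}.
  move=> mK x /(@radn_anti V 1 (l - 2)) h.
  have /h : (0 < l - 2)%N by lia.
  by move=> /andP[_ /asboolP]; apply.
have [J [Jpr Jmax]] : local_module (quotmod (radn V (l - 2))).
  apply: uniserial_local => //; apply: contrapT => q0.
  have [_ + _] := ml; apply=> x _; apply: (radK _ ml).
  apply/quot_proj_eq0/eqP; apply: contrapT => /negP qx.
  by apply: q0; exists (quot_proj _ x).
have [J' J'P] := quotmod_preimage J.
exists J'; split=> [h|L Lpr x Lx].
  apply: Jpr => q _; have [x <-] := quot_proj_surj q.
  exact/J'P/h.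
(* [L] itself need not contain [radn V (l - 2)], but a maximal [K] above it does, so [K] is the
   preimage of its image [K']. *)
have [K mK LK] := proper_sub_maximal cs Lpr.
have [_ Kpr _] := mK.
have [K' K'P] : exists K' : submodClosed (quotmod (radn V (l - 2))),
    forall x, quot_proj _ x \in K' <-> x \in K.
  have [] := @submod_comprehension A (quotmod (radn V (l - 2)))
    (fun q => exists2 y, y \in K & quot_proj _ y = q).
  - by exists 0; rewrite ?rpred0 ?linear0.
  - move=> _ _ [y Ky <-] [z Kz <-]; exists (y + z); first exact: rpredD.
    by rewrite linearD.
  - move=> a _ [y Ky <-]; exists (a *: y); first exact: rpredZ.
    by rewrite linearZ.
  move=> K' K'P; exists K' => y; rewrite K'P; split=> [[z Kz]|Ky].
    move/quot_proj_eq/(radK _ mK) => Kzy.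
    by rewrite -[y](subKr z) submodB.
  by exists y.
apply/J'P; apply: (Jmax K') => [h|]; last exact/K'P/LK.
by apply: Kpr => y _; apply/K'P/h.
Qed.

End Serial.

(** The Nakayama hypothesis enters the theorem only through this consequence. *)
Lemma indecomposable_local (Lambda : pzRingType) (V : rmodType Lambda) :
  right_2_Nakayama Lambda -> finitely_generated V -> indecomposable V ->
  local_module V.
Proof.
move=> [nak _] fgV indV; have [[V0 uV]|tV] := nak V fgV indV.
  exact: uniserial_local.
exact: two_factor_serial_local.
Qed.

(** * Descending chains and minimal idempotents *)

Section DescendingChains.

Definition dcc (A : pzRingType) (V : lmodType A) : Prop :=
  forall I : nat -> submodClosed V, (forall n, {subset I n.+1 <= I n}) ->
  exists n, forall m, (n <= m)%N -> I m =i I n.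

Lemma chain_anti (A : pzRingType) (V : lmodType A)
    (I : nat -> submodClosed V) : (forall n, {subset I n.+1 <= I n}) ->
  forall n m, (n <= m)%N -> {subset I m <= I n}.
Proof.
move=> dI n; elim=> [|m IH]; first by rewrite leqn0 => /eqP-> x.
by rewrite leq_eqVlt => /predU1P[<- x //|nm x /dI]; apply: IH.
Qed.

Lemma fg_dcc (R : comPzRingType) (V : lmodType R) :
  artinian_ring R -> finitely_generated V -> dcc V.
Proof.
move=> artR [s sV] I dI.
(* This form makes sense for a list that does not generate [V], and coefficients indexed by [nat]
   can be shifted: both are needed for induction on [s]. *)
suff [n nP] : exists n, forall m, (n <= m)%N -> forall a : nat -> R,
    \sum_(i < size s) a i *: s`_i \in I n ->
    \sum_(i < size s) a i *: s`_i \in I m.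
  exists n => m nm; apply: eq_submod; first exact: chain_anti nm.
  move=> x; have [a ->] := sV x.
  pose b i := if insub i is Some j then a j else 0.
  have -> : \sum_(i < size s) a i *: s`_i = \sum_(i < size s) b i *: s`_i.
    by apply: eq_bigr => i _; rewrite /b valK.
  exact: nP.
elim: s {sV} => [|y s [n1 IH]].
  by exists 0%N => m _ a; rewrite !big_ord0 !rpred0.
(* The leading coefficients at [y] of the elements of [I n] form a descending chain of ideals of
   [R]. *)
pose P n (r : R^o) := exists a : nat -> R,
  r *: y + \sum_(i < size s) a i *: s`_i \in I n.
have Pideal n : exists K : submodClosed R^o, forall r, r \in K <-> P n r.
  apply: submod_comprehension.
  - exists (fun=> 0); rewrite scale0r big1 ?addr0 ?rpred0 // => i _.
    by rewrite scale0r.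
  - move=> r r' [a Ia] [a' Ia']; exists (fun i => a i + a' i).
    under eq_bigr => i _ do rewrite scalerDl.
    by rewrite big_split scalerDl addrACA rpredD.
  - move=> t r [a Ia]; exists (fun i => t * a i).
    under eq_bigr => i _ do rewrite -scalerA.
    by rewrite -scaler_sumr -scalerA -scalerDr rpredZ.
have [K KP] := choice Pideal.
have [|n2 n2P] := artR K.
  by move=> n r /KP[a Ia]; apply/KP; exists a; apply: dI.
exists (maxn n1 n2) => m; rewrite geq_max => /andP[n1m n2m] a.
rewrite big_ord_recl /=; set r := a 0%N => Ia.
have /KP[b Ib] : r \in K m.
  rewrite n2P //; apply/KP; exists (fun i => a i.+1).
  exact: chain_anti (leq_maxr n1 n2) _ Ia.
(* Two combinations with the same leading coefficient differ by one over [s] alone, to which the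
   induction hypothesis applies. *)
pose d i := a i.+1 - b i.
have dE : \sum_(i < size s) d i *: s`_i =
    (r *: y + \sum_(i < size s) a i.+1 *: s`_i) -
    (r *: y + \sum_(i < size s) b i *: s`_i).
  rewrite opprD addrACA subrr add0r -sumrB.
  by apply: eq_bigr => i _; rewrite /d scalerBl.
rewrite -[_ + _](subrK (r *: y + \sum_(i < size s) b i *: s`_i)).
rewrite rpredD // -dE; apply: IH => //; rewrite dE submodB //.
  exact: chain_anti (leq_maxl n1 n2) _ Ia.
exact: chain_anti n1m _ Ib.
Qed.

Lemma artin_algebra_dcc (R : comPzRingType) (Lambda : algType R) :
  artin_algebra Lambda -> dcc ((Lambda : pzRingType)^c)^o.
Proof.
move=> [artR fgL] I dI.
have Isub n : exists K : submodClosed (Lambda : lmodType R),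
    forall x, x \in K <-> x \in I n.
  apply: submod_comprehension => [|x y|r x Ix]; [exact: rpred0|exact: rpredD|].
  (* Right ideals are [R]-submodules because [r] acts as right multiplication by [r *: 1]. *)
  have -> : r *: x = x * (r *: 1) by rewrite -scalerAr mulr1.
  exact: (rpredZ (r *: 1 : Lambda^c)).
have [K KI] := choice Isub.
have [|n nP] := fg_dcc artR fgL (I := K).
  by move=> n x /KI/dI/KI.
exists n => m /nP KE x.
by apply/idP/idP => /KI Kx; apply/KI; rewrite ?KE // -KE.
Qed.

(** Otherwise choice yields strictly decreasing idempotents [u n]. The left ideals they generate,
    written as the [x] with [x * u n = x], stabilise, which forces [u n.+1 = u n]. *)
Lemma minimal_idempotent (A : pzRingType) (Q : A -> Prop) (e0 : A) :
    dcc A^o -> Q e0 -> (forall e, Q e -> e * e = e) ->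
  exists2 e, Q e &
    forall e', Q e' -> e * e' = e' -> e' * e = e' -> e' = e.
Proof.
move=> dccA Q0 Qid; apply: contrapT => nomin.
pose smaller (e e' : {e | Q e}) :=
  [/\ sval e * sval e' = sval e', sval e' * sval e = sval e' &
      sval e' <> sval e].
have step e : exists e', smaller e e'.
  apply: contrapT => ne; apply: nomin; exists (sval e); first exact: svalP.
  move=> e' Qe' h1 h2; apply: contrapT => h3; apply: ne.
  by exists (exist _ e' Qe').
have [f fP] := choice step.
pose u n := iter n f (exist _ e0 Q0).
have Ileft n : exists K : submodClosed A^o,
    forall x, x \in K <-> (x : A) * sval (u n) = x.
  apply: submod_comprehension => [|x y Kx Ky|a x Kx]; first exact: mul0r.
    by rewrite mulrDl Kx Ky.
  by rewrite -[a *: x]/(a * x) -mulrA Kx.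
have [I IP] := choice Ileft.
have [|n nP] := dccA I.
  move=> n x /IP /= h; apply/IP; have [_ h2 _] := fP (u n).
  by rewrite -{1}h -mulrA h2.
have /IP h : sval (u n) \in I n.+1.
  by rewrite nP //; apply/IP/Qid/svalP.
by have [h1 _ []] := fP (u n); rewrite -h1.
Qed.

End DescendingChains.

(** * Indecomposable projectives mapping onto a local module *)

Section ProjectiveCover.
Variables (A : pzRingType) (V : lmodType A) (J : submodClosed V).
Hypothesis (dccA : dcc A^o) (Jl : largest_proper_submod J).

(* With [m] outside [J] and [e] a minimal idempotent such that [e *: m] is
   outside [J], the module [A e] is indecomposable and maps onto [V] by
   [x |-> x *: m]. It is represented as [A / {x | x * e = 0}]. *)
Lemma local_quotient_projective :
  exists (P : lmodType A) (N : submodClosed P),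
    [/\ finitely_generated P, indecomposable P, projective P
      & isomorphic V (quotmod N)].
Proof.
have [Jpr Jmax] := Jl.
have [m mJ] : exists m, m \notin J.
  apply: contrapT => h; apply: Jpr => x _; apply: contrapT => /negP Jx.
  by apply: h; exists x.
have [||e [ee emJ] emin] := minimal_idempotent
  (Q := fun e => e * e = e /\ e *: m \notin J) (e0 := 1) dccA.
- by rewrite mulr1 scale1r.
- by move=> e [].
have [N0 N0P] : exists K : submodClosed A^o,
    forall x, x \in K <-> (x : A) * e = 0.
  apply: submod_comprehension => [|x y Kx Ky|a x Kx]; first exact: mul0r.
    by rewrite mulrDl Kx Ky addr0.
  by rewrite -[a *: x]/(a * x) -mulrA Kx mulr0.
pose pr (a : A) : quotmod N0 := quot_proj N0 a.
have prZ a : pr a = a *: pr 1.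
  by rewrite /pr -linearZ -[a *: (1 : A^o)]/(a * 1) mulr1.
have pr_surj q : exists a, pr a = q := quot_proj_surj q.
have pre a : pr (a * e) = pr a.
  by apply/quot_proj_eq/N0P; rewrite mulrBl -mulrA ee subrr.
(* Three uses follow: the embedding [i] onto [A e], the map [g] to [V], and projectivity. *)
have lift (U : lmodType A) (u : U) : exists h : {linear quotmod N0 -> U},
    forall x : A, h (pr x) = (x * e) *: u.
  have [f fE] : exists f : {linear A^o -> U}, forall x : A, f x = (x * e) *: u.
    apply: (@linear_of A A^o U (fun x : A => (x * e) *: u)) => a x y.
    by rewrite scalerA mulrA -scalerDl -mulrDl.
  have [x Nx|h hE] := @quot_lift _ _ N0 _ f.
    by rewrite fE (N0P _).1 // scale0r.
  by exists h => x; rewrite hE fE.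
have [i iE] := lift A^o (1 : A).
have {}iE x : i (pr x) = x * e by rewrite iE -[LHS]/(x * e * 1) mulr1.
have i_inj q : i q = 0 -> q = 0.
  by have [a <-] := pr_surj q; rewrite iE => /N0P/quot_proj_eq0.
have [g gE] := lift V m.
have [N NP] : exists N : submodClosed (quotmod N0),
    forall q, q \in N <-> g q = 0.
  apply: submod_comprehension => [|x y Kx Ky|a x Kx].
  - exact: linear0.
  - by rewrite linearD Kx Ky addr0.
  - by rewrite linearZ /= Kx scaler0.
exists (quotmod N0), N; split.
- exists [:: pr 1] => q; have [a <-] := pr_surj q.
  by exists (fun=> a); rewrite big_ord_recl big_ord0 addr0 /= prZ.
- split.
    exists (pr 1); apply/eqP => /quot_proj_eq0/N0P; rewrite mul1r => e0.
    by move: emJ; rewrite e0 scale0r rpred0.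
  move=> K L KL; have [/(_ (pr 1)) [/(_ isT) [k [l [Kk Ll klE]]] _] _] := KL.
  (* If the component [k'] of the generator still moves [m] outside [J], then [i k'] is an
     idempotent below [e]. Minimality gives [i k' = e], so [l'] and then [L'] vanish. *)
  have half (K' L' : submodClosed (quotmod N0)) k' l' :
      direct_sum (full_submod _) K' L' -> k' \in K' -> l' \in L' ->
      pr 1 = k' + l' -> i k' *: m \notin J -> L' =i zero_submod (quotmod N0).
    move=> [sumKL KL0] Kk' Ll' eq1 mk'.
    have eqs (a a' : A) : pr a = pr a' -> a *: k' = a' *: k'.
      rewrite prZ [pr a']prZ eq1 !scalerDr => eqaa.
      have : a *: k' - a' *: k' = 0.
        apply: KL0; first by rewrite submodB ?rpredZ.
        have -> : a *: k' - a' *: k' = a' *: l' - a *: l'.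
          by apply/eqP; rewrite subr_eq addrAC [X in X - _]addrC -eqaa addrK.
        by rewrite submodB ?rpredZ.
      by move/eqP; rewrite subr_eq0 => /eqP.
    have [x xE] := pr_surj k'.
    have ex : e *: k' = k'.
      by have := eqs (1 * e) 1 (pre 1); rewrite mul1r scale1r.
    (* Compare components in [k' = x *: pr 1 = x *: k' + x *: l']. *)
    have kx : x *: k' = k'.
      apply/esym/eqP; rewrite -subr_eq0; apply/eqP/KL0.
        by rewrite submodB ?rpredZ.
      by rewrite -{1}xE prZ eq1 scalerDr addrC addKr rpredZ.
    have ik : i k' = x * e by rewrite -xE iE.
    have eik : i k' = e.
      apply: emin.
      - split=> //; rewrite {1}ik -[_ * i k']/(_ *: i k') -linearZ.
        by rewrite -scalerA ex kx.
      - by rewrite -[_ * i k']/(e *: i k') -linearZ /= ex.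
      - by rewrite ik -mulrA ee.
    have l0 : l' = 0.
      apply: i_inj; apply: (addrI (i k')).
      by rewrite -linearD -eq1 iE mul1r addr0 eik.
    apply: eq_submod => q; last by move=> /eqP->; apply: rpred0.
    move=> Lq; apply/eqP/KL0 => //; have [a <-] := pr_surj q.
    by rewrite prZ eq1 l0 addr0 rpredZ.
  (* Since [e = i k + i l], at least one of the two components keeps [m] outside [J]. *)
  have [mk|mk] := boolP (i k *: m \in J).
    left; apply: (half L K l k (direct_sumC KL)) => //; first by rewrite addrC.
    apply/negP => ml; case/negP: emJ.
    have -> : e = i k + i l by rewrite -linearD -klE iE mul1r.
    by rewrite scalerDl rpredD.
  by right; apply: (half K L k l).
- move=> U W p f psurj; have [u uE] := psurj (f (pr e)).
  have [h hE] := lift U u; exists h => q; have [a <-] := pr_surj q.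
  by rewrite hE linearZ uE -linearZ /= [pr e]prZ scalerA -mulrA ee -prZ pre.
- apply: (@first_isomorphism _ _ _ _ g) => // v; last by rewrite NP.
  (* The image of [g] contains [e *: m], so it is not inside [J] and must be all of [V]. *)
  apply: contrapT => nv.
  have [K KP] : exists K : submodClosed V,
      forall v, v \in K <-> exists q, g q = v.
    apply: submod_comprehension => [|x y [q <-] [r <-]|a x [q <-]].
    - by exists 0; rewrite linear0.
    - by exists (q + r); rewrite linearD.
    - by exists (a *: q); rewrite linearZ.
  case/negP: emJ; apply: (Jmax K).
    by move=> h; apply: nv; apply/KP/h.
  by apply/KP; exists (pr 1); rewrite gE mul1r.
Qed.

End ProjectiveCover.

(** * Finite generation of a sum of two images *)

Section FinitelyGenerated.
Variable A : pzRingType.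

Lemma finitely_generatedP (V : lmodType A) : finitely_generated V <->
  exists s : seq V, forall x, exists a : nat -> A,
    x = \sum_(i < size s) a i *: s`_i.
Proof.
split=> -[s sV]; exists s => x; have [a ->] := sV x; last by exists a.
exists (fun i => if insub i is Some j then a j else 0).
by apply: eq_bigr => i _; rewrite valK.
Qed.

Lemma finitely_generated_add (U V W : lmodType A)
    (p : {linear U -> W}) (q : {linear V -> W}) :
    finitely_generated U -> finitely_generated V ->
    (forall w, exists x y, w = p x + q y) ->
  finitely_generated W.
Proof.
move=> /finitely_generatedP[s sU] /finitely_generatedP[t tV] pq.
apply/finitely_generatedP; exists (map p s ++ map q t) => w.
have [x [y ->]] := pq w; have [[a ->] [b ->]] := (sU x, tV y).
exists (fun i => if (i < size s)%N then a i else b (i - size s)%N).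
rewrite size_cat !size_map big_split_ord !linear_sum /=; congr (_ + _).
  apply: eq_bigr => i _; rewrite nth_cat size_map ltn_ord.
  by rewrite linearZ (nth_map 0).
apply: eq_bigr => i _; rewrite nth_cat size_map ltnNge leq_addr /= addKn.
by rewrite linearZ (nth_map 0).
Qed.

End FinitelyGenerated.

(** * Comparing quotients by two complements of a simple submodule *)

Section Amalgam.
Variables (A : pzRingType) (P : lmodType A).
Implicit Types (X : lmodType A) (J K L N S : submodClosed P).

Lemma local_rad : local_module P -> largest_proper_submod (radn P 1).
Proof.
move=> [J Jl]; have eJ := largest_proper_rad Jl; have [Jpr Jmax] := Jl.
split=> [h|L /Jmax LJ x Lx]; last by rewrite -eJ LJ.
by apply: Jpr => x /h; rewrite eJ.
Qed.

Lemma simple_submod_cap S L : simple_submod S ->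
  {subset S <= L} \/ (forall x, x \in S -> x \in L -> x = 0).
Proof.
move=> [_ /(_ (capm S L))[x /capmP[]//|e|e]]; [right|left].
  by move=> x Sx Lx; apply/eqP; rewrite -[_ == 0]/(x \in zero_submod P) -e;
     apply/capmP.
by move=> x; rewrite -e => /capmP[].
Qed.

Section Amalgamation.
Variables (J S : submodClosed P).
Hypotheses (Jl : largest_proper_submod J) (Ssimple : simple_submod S).

(** If [L] meets [S] trivially and is proper, it lies in [J = N + S], and the modular law gives
    [L = N]. *)
Lemma above_complement N L : direct_sum J N S -> {subset N <= L} ->
  {subset S <= L} \/ {subset L <= N}.
Proof.
move=> [JNS _] NL; have [//|SL0] := simple_submod_cap L Ssimple; first by left.
have [fL|/Jl.2 LJ] := EM {subset full_submod P <= L}; [left|right] => x Lx.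
  exact: fL.
have /JNS[n [s [Nn Ss xE]]] := LJ x Lx.
suff s0 : s = 0 by rewrite xE s0 addr0.
by apply: SL0 => //; rewrite -(addKr n s) -xE addrC submodB // NL.
Qed.

(** The composite of [p] with the projection to [X / B] is onto with kernel [N]: [B] is a complement
    to the image of [p]. *)
Lemma amalgam_quotient X (p q : {linear P -> X}) N N' (B : submodClosed X) s0 :
    direct_sum J N S -> direct_sum J N' S ->
    (forall w, exists x y, w = p x + q y) ->
    (forall x, x \in N -> p x = 0) -> (forall y, y \in N' -> q y = 0) ->
    (forall s, s \in S -> p s + q s = 0) ->
    ~ {subset B <= zero_submod X} -> s0 \in S -> p s0 \notin B ->
  isomorphic (quotmod B) (quotmod N).
Proof.
move=> JNS JN'S pq pN qN' pqS Bn0 Ss0 ps0.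
have qJ y : y \in J -> exists2 s, s \in S & q y = - p s.
  move=> /JN'S.1[n [s [N'n Ss ->]]]; exists s => //.
  by rewrite linearD qN' // add0r; apply/eqP; rewrite -addr_eq0 addrC pqS.
(* The preimage of [B] under [p] contains [N] but not [s0], so [above_complement] puts it inside
   [N]. *)
have pB x : p x \in B -> x \in N.
  have [L LP] : exists L, forall x, x \in L <-> p x \in B.
    apply: submod_comprehension => [|y z By Bz|a y By].
    - by rewrite linear0 rpred0.
    - by rewrite linearD rpredD.
    - by rewrite linearZ rpredZ.
  have [y Ny|SL|LN /LP/LN//] := above_complement (L := L) JNS.
    by apply/LP; rewrite pN ?rpred0.
  by case/negP: ps0; apply/LP/SL.
have [L LP] : exists L, forall y, y \in L <-> exists x, q y - p x \in B.
  apply: submod_comprehension => [|y y' [x Bx] [x' Bx']|a y [x Bx]].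
  - by exists 0; rewrite !linear0 addr0 rpred0.
  - by exists (x + x'); rewrite !linearD addrACA rpredD.
  - by exists (a *: x); rewrite (linearZZ q) (linearZZ p) -scalerBr rpredZ.
(* A proper [L] would lie in [J]. As [q] maps [J] into the image of [p], [B] would then lie in that
   image and vanish by [pB]. *)
have Lfull y : y \in L.
  apply: contrapT => nLy; have LJ : {subset L <= J}.
    by apply: Jl.2 => h; apply/nLy/h.
  apply: Bn0 => w Bw; have [x [y' wE]] := pq w.
  have /LJ/qJ[s Ss qE] : y' \in L.
    by apply/LP; exists (- x); rewrite linearN opprK addrC -wE.
  have wE' : w = p (x - s) by rewrite wE qE linearB.
  by rewrite wE' inE pN //; apply: pB; rewrite -wE'.
have [f fE] : exists f : {linear P -> quotmod B},
    forall x, f x = quot_proj B (p x).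
  by apply: linear_of => a x y; rewrite !linearP.
apply: (@first_isomorphism _ _ _ _ f) => [w|x]; last first.
  rewrite fE quot_proj_eq0; split=> [/pB//|/pN->]; exact: rpred0.
have [v <-] := quot_proj_surj w; have [x [y ->]] := pq v.
have /LP[x' Bx'] := Lfull y; exists (x + x'); rewrite fE.
apply/quot_proj_eq; rewrite (linearD p) opprD addrACA subrr add0r -opprB.
exact: submodN.
Qed.

(* [X], the amalgam of [P/N] and [P/N'] along the images of [S], has two proper
   submodules [P/N] and [P/N'] with sum [X]; hence it is decomposable, and a
   summand [B] that does not contain the image of [S] is a complement to both
   copies. *)
Lemma complement_quotients N N' :
    (forall X, finitely_generated X -> indecomposable X -> local_module X) ->
    finitely_generated P ->
    direct_sum J N S -> direct_sum J N' S ->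
  isomorphic (quotmod N) (quotmod N').
Proof.
move=> ind_local fgP JNS JN'S.
(* [K] is [N * N'] plus the diagonal of [S], so the two copies of [S] are glued with a sign:
   [p s = - q s]. *)
have [K KP] : exists K : submodClosed (P * P)%type, forall u, u \in K <->
    exists2 s, s \in S & u.1 - s \in N /\ u.2 - s \in N'.
  apply: submod_comprehension.
  - by exists 0; rewrite ?subr0 !rpred0.
  - move=> u v [s Ss [Ns N's]] [t St [Nt N't]]; exists (s + t).
      exact: rpredD.
    by split; rewrite /= opprD addrACA rpredD.
  - move=> a u [s Ss [Ns N's]]; exists (a *: s); first exact: rpredZ.
    by rewrite /= -!scalerBr !rpredZ.
pose X : lmodType A := quotmod K.
have [p pE] : exists p : {linear P -> X}, forall x, p x = quot_proj K (x, 0).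
  apply: linear_of => a x y; rewrite -linearP; congr (quot_proj K _).
  by congr pair; rewrite /= scaler0 addr0.
have [q qE] : exists q : {linear P -> X}, forall y, q y = quot_proj K (0, y).
  apply: linear_of => a x y; rewrite -linearP; congr (quot_proj K _).
  by congr pair; rewrite /= scaler0 addr0.
have pqE x y : p x + q y = quot_proj K (x, y).
  by rewrite pE qE -linearD; congr (quot_proj K _); congr pair;
    rewrite ?addr0 ?add0r.
have pq w : exists x y, w = p x + q y.
  by have [[x y] <-] := quot_proj_surj w; exists x, y.
have pq0 x y : p x + q y = 0 -> x \in J /\ y \in J.
  rewrite pqE => /quot_proj_eq0/KP[s Ss /= [Ns N's]].
  by split; [apply/JNS.1|apply/JN'S.1]; [exists (x - s), s|exists (y - s), s];
     rewrite subrK.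
have pN x : x \in N -> p x = 0.
  by move=> Nx; rewrite pE; apply/quot_proj_eq0/KP; exists 0;
     rewrite ?subr0 ?rpred0.
have qN' x : x \in N' -> q x = 0.
  by move=> Nx; rewrite qE; apply/quot_proj_eq0/KP; exists 0;
     rewrite ?subr0 ?rpred0.
have pqS s : s \in S -> p s + q s = 0.
  by move=> Ss; rewrite pqE; apply/quot_proj_eq0/KP; exists s;
     rewrite //= subrr !rpred0.
have pS s : s \in S -> p s = 0 -> s = 0.
  move=> Ss; rewrite pE => /quot_proj_eq0/KP[t St /= [Nst]].
  rewrite sub0r => /submodN; rewrite opprK => N't.
  have t0 := JN'S.2 t N't St; rewrite t0 subr0 in Nst.
  exact: JNS.2.
have [z zJ] : exists z, z \notin J.
  apply: contrapT => h; apply: Jl.1 => x _; apply: contrapT => /negP Jx.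
  by apply: h; exists x.
(* By [pq0] neither [p] nor [q] is onto, since [q z] and [p z] are missed; a largest proper
   submodule would contain both images, hence [X]. *)
have nlocal : ~ local_module X.
  move=> [M [Mpr Mmax]]; apply: Mpr => w _.
  have range_proper (r : {linear P -> X}) :
      ~ (forall w, exists x, r x = w) -> forall x, r x \in M.
    move=> nr x; have [L LP] : exists L : submodClosed X,
        forall w, w \in L <-> exists x, r x = w.
      apply: submod_comprehension => [|_ _ [y <-] [t <-]|a _ [y <-]].
      - by exists 0; rewrite linear0.
      - by exists (y + t); rewrite linearD.
      - by exists (a *: y); rewrite linearZ.
    apply: (Mmax L); last by apply/LP; exists x.
    by move=> h; apply: nr => v; apply/LP/h.
  have [x [y ->]] := pq w; apply: rpredD; apply: range_proper => h.
    have [t tE] := h (q z); case/negP: zJ.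
    have [_ /submodN] : t \in J /\ - z \in J.
      by apply: pq0; rewrite linearN tE subrr.
    by rewrite opprK.
  have [t tE] := h (p z); case/negP: zJ.
  by have [] : z \in J /\ - t \in J by apply: pq0; rewrite linearN tE subrr.
have fgX : finitely_generated X := finitely_generated_add fgP fgP pq.
have X0 : nonzero_module X.
  exists (p z); apply/eqP => pz; case/negP: zJ.
  by have [] := pq0 z 0; rewrite // linear0 addr0.
have [s0 Ss0 s00] : exists2 s, s \in S & s != 0.
  apply: contrapT => h; case: Ssimple => n0 _; apply: n0 => s Ss.
  by apply: contrapT => /negP s0; apply: h; exists s.
(* If every nonzero submodule contained [p s0], no two of them could form a direct sum, and [X]
   would be indecomposable, hence local. *)
have [B Bn0 Bs0] : exists2 B : submodClosed X,
    ~ {subset B <= zero_submod X} & p s0 \notin B.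
  apply: contrapT => nB; apply: nlocal; apply: ind_local => //; split=> //.
  move=> B C [_ BC0].
  have case0 (D : submodClosed X) : D =i zero_submod X \/ p s0 \in D.
    have [D0|D0] := EM {subset D <= zero_submod X}; [left|right].
      by apply: eq_submod => // x /eqP->; apply: rpred0.
    by apply: contrapT => /negP Ds0; apply: nB; exists D.
  have [B0|Bs0] := case0 B; [by left|have [C0|Cs0] := case0 C; [by right|]].
  by move: s00; rewrite (pS s0) ?eqxx //; apply: BC0.
(* The same [B] serves with [p] and [q] exchanged, because [q s0 = - p s0]. *)
apply: isomorphic_trans (amalgam_quotient JN'S JNS _ qN' pN _ Bn0 Ss0 _).
- apply: isomorphic_sym.
  exact: (amalgam_quotient JNS JN'S pq pN qN' pqS Bn0 Ss0 Bs0).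
- by move=> w; have [x [y ->]] := pq w; exists y, x; rewrite addrC.
- by move=> s Ss; rewrite addrC pqS.
- apply: contra Bs0 => Bq; have /eqP := pqS s0 Ss0.
  by rewrite addr_eq0 => /eqP->; apply: submodN.
Qed.

End Amalgamation.
End Amalgam.

(** * The quotients of the two kinds of projectives *)

Lemma quotient_radical_sum_simples (A : pzRingType) (P M : lmodType A)
    (N S1 S2 : submodClosed P) :
    (forall X : lmodType A, finitely_generated X -> indecomposable X ->
       local_module X) ->
    finitely_generated P -> indecomposable P ->
    nonzero_module M -> isomorphic M (quotmod N) ->
    simple_submod S1 -> simple_submod S2 -> direct_sum (radn P 1) S1 S2 ->
  [\/ isomorphic M P, isomorphic M (quotmod (radn P 1)),
      isomorphic M (quotmod S1) | isomorphic M (quotmod S2)].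
Proof.
move=> ind_local fgP indP [m m0] isoM simS1 simS2 radS.
have Jl := local_rad (ind_local P fgP indP).
(* Extensionally equal submodules may give distinct quotient types, so an isomorphism is
   supplied. *)
have isoN (K : submodClosed P) : N =i K -> isomorphic M (quotmod K).
  move=> eNK; apply: isomorphic_trans isoM _.
  apply: (@first_isomorphism _ _ _ _ (quot_proj N)).
    exact: quot_proj_surj.
  by move=> x; rewrite quot_proj_eq0 eNK.
have Nrad : {subset N <= radn P 1}.
  apply: Jl.2 => fN; have [f [g fK _]] := isoM.
  case/eqP: m0; apply: (can_inj fK); rewrite linear0.
  by have [x <-] := quot_proj_surj (f m); apply/quot_proj_eq0/fN.
have NE x : x \in N -> exists s1 s2, [/\ s1 \in S1, s2 \in S2 & x = s1 + s2].
  by move=> /Nrad/radS.1.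
have [S1N|S1N0] := simple_submod_cap N simS1;
  have [S2N|S2N0] := simple_submod_cap N simS2.
- apply: Or42; apply: isoN; apply: eq_submod => // _ /radS.1[y [z [? ? ->]]].
  by apply: rpredD; [apply: S1N | apply: S2N].
- apply: Or43; apply: isoN; apply: eq_submod => // x Nx.
  have [y [z [S1y S2z xE]]] := NE x Nx; rewrite xE (S2N0 z) ?addr0 //.
  by have -> : z = x - y; [rewrite xE addrC addKr | rewrite submodB // S1N].
- apply: Or44; apply: isoN; apply: eq_submod => // x Nx.
  have [y [z [S1y S2z xE]]] := NE x Nx; rewrite xE (S1N0 y) ?add0r //.
  by have -> : y = x - z; [rewrite xE addrK | rewrite submodB // S2N].
(* Here [N] contains neither simple. Either [S1] meets [N + S2] trivially and [N = 0], or [N] is,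
   like [S1], a complement of [S2] in the radical. *)
have [S1NS2|NS20] := simple_submod_cap (addm N S2) simS1; last first.
  apply: Or41; apply: isomorphic_trans isoM _; apply: isomorphic_sym.
  apply: (@first_isomorphism _ _ _ _ idfun) => [x|x]; first by exists x.
  split=> /= [->|Nx]; first exact: rpred0.
  have [y [z [S1y S2z xE]]] := NE x Nx.
  have y0 : y = 0.
    apply: NS20 => //; apply/addmP; exists x, (- z).
    by split; [|apply: submodN|rewrite xE addrK].
  have xz : x = z by rewrite xE y0 add0r.
  by apply: S2N0; rewrite // xz.
apply: Or43; apply: isomorphic_trans isoM _.
apply: (complement_quotients Jl simS2) => //.
split=> [x|x Nx S2x]; last exact: S2N0.
split=> [/radS.1[y [z [/S1NS2/addmP[n [s [Nn S2s ->]]] S2z ->]]]|].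
  by exists n, (s + z); rewrite rpredD ?addrA.
move=> [n [s [/Nrad Jn S2s ->]]]; rewrite rpredD //.
by apply/radS.1; exists 0, s; rewrite rpred0 add0r.
Qed.

Lemma quotient_uniserial (A : pzRingType) (P M : lmodType A)
    (N : submodClosed P) :
    nonzero_module M -> isomorphic M (quotmod N) -> uniserial P ->
  exists i : nat, (1 <= i <= loewy_length P)%N /\
    isomorphic M (quotmod (radn P i)).
Proof.
move=> [m m0] isoM [l [c [cs uniq_cs]]].
have [j jl NE] := uniserial_submod cs uniq_cs N.
have ll := loewy_length_uniserial cs uniq_cs.
(* [N = c j] is [radn P (l - j)]; the exponent is positive because [j = l] would make [M] zero. *)
exists (l - j)%N; split; last first.
  apply: isomorphic_trans isoM _.
  apply: (@first_isomorphism _ _ _ _ (quot_proj N)).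
    exact: quot_proj_surj.
  move=> x; rewrite quot_proj_eq0 (radn_uniserial cs uniq_cs) ?leq_subr //.
  by rewrite subKn // NE.
rewrite (leq_trans (leq_subr _ _) ll) andbT subn_gt0 ltn_neqAle jl andbT.
apply/eqP => jE; have [_ cl _] := cs; have [f [g fK _]] := isoM.
case/eqP: m0; apply: (can_inj fK); rewrite linear0.
by have [x <-] := quot_proj_surj (f m); apply/quot_proj_eq0; rewrite NE jE cl.
Qed.

Theorem proposition5p6 (R : comPzRingType) (Lambda : algType R)
    (M : rmodType Lambda) :
  artin_algebra Lambda -> right_2_Nakayama Lambda ->
  finitely_generated M -> indecomposable M ->
  (exists (P : rmodType Lambda) (N : submodClosed P),
     [/\ finitely_generated P, indecomposable P, projective P
       & isomorphic M (quotmod N)]) /\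
  (forall (P : rmodType Lambda) (N : submodClosed P),
     finitely_generated P -> indecomposable P -> projective P ->
     isomorphic M (quotmod N) ->
     (uniserial P ->
        exists i : nat, (1 <= i <= loewy_length P)%N /\
          isomorphic M (quotmod (radn P i))) /\
     (two_factor_serial P ->
        forall S1 S2 : submodClosed P,
          simple_submod S1 -> simple_submod S2 ->
          radn P 1 =i soc P -> direct_sum (radn P 1) S1 S2 ->
          [\/ isomorphic M P, isomorphic M (quotmod (radn P 1)),
              isomorphic M (quotmod S1) | isomorphic M (quotmod S2)])).
Proof.
move=> artL nakL fgM indM; have ind_local X := @indecomposable_local _ X nakL.
split.
  have [J Jl] := ind_local M fgM indM.
  exact: local_quotient_projective (artin_algebra_dcc artL) Jl.
move=> P N fgP indP _ isoM; have [M0 _] := indM; split.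
  exact: quotient_uniserial M0 isoM.
move=> _ S1 S2 simS1 simS2 _ radS.
exact: quotient_radical_sum_simples ind_local fgP indP M0 isoM simS1 simS2 radS.
Qed.
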